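(* Let $V=V_0\oplus V_1\oplus V_2$ with $V_0=\langle v\rangle$, $V_1=\langle w\rangle$, $V_2=\langle x\rangle$ one-dimensional, equipped with the skew symmetric linear operators $l_r:V^{\otimes r}\to V$ of degree $2-r$ ($r\ge 1$) given by constants $a_r,b_r,c_r$ via $$l_r(v\otimes w^{\otimes r-1})=a_r w\ (r\ge1),\qquad l_r(w^{\otimes r})=b_r x\ (r\ge 1),\qquad l_r(v\otimes w^{\otimes r-2}\otimes x)=c_r x\ (r\ge 2).$$ Suppose that $V$ with these operators is an $L_3$ structure. Then $V$ is a differential graded Lie algebra if and only if $b_1=0$ or $b_2=0$ or $a_2=0$.
   Context: All vector spaces are graded, over a fixed field of characteristic zero; $|x|$ is the degree of $x$. For a permutation $\sigma$ of a string of homogeneous elements, $\varepsilon(\sigma)$ is the Koszul sign (a factor $(-1)^{pq}$ whenever elements of degrees $p$ and $q$ are commuted) and $\chi(\sigma)=(-1)^{\sigma}\varepsilon(\sigma)$, where $(-1)^\sigma$ is the sign of $\sigma$. A $(p,n-p)$ unshuffle is $\sigma\in S_n$ with $\sigma(1)<\dots<\sigma(p)$ and $\sigma(p+1)<\dots<\sigma(n)$. A linear map $l:V^{\otimes n}\to V$ has degree $k$ if $l(x_1\otimes\dots\otimes x_n)\in V_N$ with $N=k+\sum|x_i|$; it is skew symmetric if $l(x_{\pi(1)}\otimes\dots\otimes x_{\pi(n)})=\chi(\pi)\,l(x_1\otimes\dots\otimes x_n)$ for all $\pi\in S_n$. Given skew symmetric maps $l_k$, define $\mathcal J_n:V^{\otimes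 n}\to V$ by $$\mathcal J_n(x_1\otimes\dots\otimes x_n)=\sum_{p=1}^n(-1)^{p(n-p)}\sum_{\sigma\ (p,n-p)\text{ unshuffle}}\chi(\sigma)\,l_{n-p+1}\big(l_p(x_{\sigma(1)}\otimes\dots\otimes x_{\sigma(p)})\otimes x_{\sigma(p+1)}\otimes\dots\otimes x_{\sigma(n)}\big).$$ $V$ is $L_m$ (an $L_m$ structure) if the maps $l_k$, $1\le k\le m$, are skew symmetric, linear, of degree $2-k$, and $\mathcal J_n=0$ for all $1\le n\le m$. A differential graded Lie algebra is an $L_2$ structure $(V,l_1,l_2)$ which satisfies $\sum_{\sigma\ (2,1)\text{ unshuffle}}\chi(\sigma)\,l_2(l_2(x_{\sigma(1)}\otimes x_{\sigma(2)})\otimes x_{\sigma(3)})=0$ for all $x_1,x_2,x_3$ (no condition is imposed on the higher operators $l_n$, $n\geq 3$). In the claim, $v,w,x$ have degrees $0,1,2$, and all other graded components of $V$ are zero. The values of $l_r$ on permutations of the listed tensors are determined by skew symmetry; $l_r$ vanishes on all other tensors of basis vectors. *)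

(* Defs.v *)
From mathcomp Require Import all_boot all_order all_fingroup all_algebra.

Set Implicit Arguments.
Unset Strict Implicit.
Unset Printing Implicit Defensive.

Import GRing.Theory.
Local Open Scope ring_scope.

Definition perm_tuple (T : Type) n (s : 'S_n) (t : n.-tuple T) : n.-tuple T :=
  [tuple tnth t (s i) | i < n].

Definition set_tuple (T : Type) n (t : n.-tuple T) (i : 'I_n) (u : T) :
    n.-tuple T :=
  [tuple if j == i then u else tnth t j | j < n].

(* Positions are numbered from 0, so the first block is [i < p]. *)
Definition unshuffle (p n : nat) (s : 'S_n) : bool :=
  [forall i : 'I_n, forall j : 'I_n,
     ((i < j) && ((j < p) || (p <= i)))%N ==> (s i < s j)%N].

Section Signs.
Variable K : fieldType.

(* In passing from x_1 ... x_n to x_(s 1) ... x_(s n), the pairs that get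
   commuted are those which occur in the new string in reverse order, i.e.
   the inversions of s. *)
Definition koszul n (s : 'S_n) (d : n.-tuple int) : K :=
  \prod_(i < n) \prod_(j < n | (i < j)%N && (s j < s i)%N)
     (-1) ^ (tnth d (s i) * tnth d (s j)).

Definition chi n (s : 'S_n) (d : n.-tuple int) : K :=
  (-1) ^+ s * koszul s d.
End Signs.

Section Operators.
Variables (K : fieldType) (V : vectType K).
(* [Vg i] is the component of degree [i] of the graded space [V]. *)
Variable Vg : int -> {vspace V}.

(* Linear maps on the n-th tensor power of V are encoded as multilinear maps
   on n-tuples.  A tuple of homogeneous elements comes with the tuple of its
   degrees, because 0 lies in every component. *)
Definition homogeneous n (d : n.-tuple int) (t : n.-tuple V) : Prop :=
  forall i, tnth t i \in Vg (tnth d i).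

Definition multilinear n (f : n.-tuple V -> V) : Prop :=
  forall (t : n.-tuple V) (i : 'I_n), linear (fun u => f (set_tuple t i u)).

Definition has_degree n (k : int) (f : n.-tuple V -> V) : Prop :=
  forall d t, homogeneous d t -> f t \in Vg (k + \sum_(i < n) tnth d i).

Definition skew_symmetric n (f : n.-tuple V -> V) : Prop :=
  forall d t (s : 'S_n), homogeneous d t ->
    f (perm_tuple s t) = chi K s d *: f t.

Definition L_operator n (f : n.-tuple V -> V) : Prop :=
  [/\ multilinear f, skew_symmetric f & has_degree (2 - n%:Z) f].

(* Only the [l n] with [0 < n] are ever used. *)
Variable l : forall n, n.-tuple V -> V.

(* The arity [minn p n] of the inner operator (that of [take p]) is [p]
   whenever [p <= n]. *)
Definition unshuffle_sum n (p : nat) (d : n.-tuple int) (t : n.-tuple V) : V :=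
  \sum_(s : 'S_n | unshuffle p s) chi K s d *:
     l [tuple of l [tuple of take p (perm_tuple s t)]
                 :: drop p (perm_tuple s t)].

Definition jacobiator n (d : n.-tuple int) (t : n.-tuple V) : V :=
  \sum_(1 <= p < n.+1) (-1) ^+ (p * (n - p)) *: unshuffle_sum p d t.

Definition L_structure (m : nat) : Prop :=
  (forall k, (1 <= k <= m)%N -> L_operator (@l k)) /\
  (forall n (d : n.-tuple int) (t : n.-tuple V), (1 <= n <= m)%N ->
     homogeneous d t -> jacobiator d t = 0).

Definition dg_Lie_algebra : Prop :=
  L_structure 2 /\
  (forall (d : 3.-tuple int) (t : 3.-tuple V),
     homogeneous d t -> unshuffle_sum 2 d t = 0).

End Operators.

(* Main.v *)
Require Import Defs.
From mathcomp Require Import all_boot all_order all_fingroup all_algebra.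
From mathcomp Require Import ring zify.

Set Implicit Arguments.
Unset Strict Implicit.
Unset Printing Implicit Defensive.

Import GRing.Theory.
Local Open Scope ring_scope.

(** Only three scalar relations matter.  On v, v @ w and v @ w @ w the
    first Jacobiators read

      J1 : a1 b1 = 0,            J2 : a2 b1 = a1 b2 + b1 c2,
      J3 : (l2 l2-part) + (terms in which l1 occurs) = 0,

    and V is a differential graded Lie algebra exactly when the l2 l2-part of
    J3 vanishes.  The operator l2 multiplies degrees into degrees and every
    graded component is at most one-dimensional, so its l2 l2-part on basis
    vectors of degrees i, j, k is a scalar multiple of the basis vector of
    degree i + j + k.  This leaves total degree at most 2, where all scalars
    vanish by antisymmetry except the one on v @ w @ w; that one is
    2 a2 b2 - b2 c2 ([Jacobi_identity_iff]).

    It remains to compare b2 c2 = 2 a2 b2 with the claim.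
    - If b2 = 0 it holds.
    - If b1 = 0 and b2 <> 0, then J2 gives a1 = 0, so l1 is zero; all terms of
      J3 other than the l2 l2-part disappear and J3 = 0 is the Jacobi identity
      ([jacobiator_3_minimal]).
    - If b1 and b2 are nonzero, then J1 gives a1 = 0 and J2 gives a2 = c2, so
      that b2 c2 = 2 a2 b2 amounts to a2 b2 = 0, i.e. to a2 = 0.

    To evaluate the Jacobiators, the (n, 1)-unshuffles of n + 1 letters are
    parametrized by the letter that is moved to the end
    ([big_unshuffle_max]), and their Koszul signs are computed
    ([chi_lift_max]). *)

(** * Permutations that increase off one point *)

(** Counting the values below [s k] along [s] itself recovers [s k]; for a
    permutation that is monotone on a set this determines its values from the
    order of the arguments. *)
Lemma perm_rank n (s : 'S_n) (k : 'I_n) :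
  (\sum_(j < n) (s j < s k))%N = s k :> nat.
Proof.
transitivity (\sum_(j < n) (j < s k)%N)%N.
  by rewrite [RHS](reindex_inj (@perm_inj _ s)).
have le_sk : (s k <= n)%N by exact/ltnW.
rewrite -[RHS]card_ord -sum1_card (big_ord_widen n (fun=> 1%N) le_sk).
by rewrite [RHS]big_mkcond; apply: eq_bigr => j _; case: ltnP.
Qed.

Lemma perm_increasing_eq1 n (s : 'S_n) :
  (forall i j : 'I_n, (i < j)%N -> (s i < s j)%N) -> s = 1%g.
Proof.
move=> s_inc; apply/permP => k; rewrite perm1; apply: val_inj => /=.
rewrite -[LHS]perm_rank -[k in RHS](perm1 k) -[RHS]perm_rank.
apply: eq_bigr => j _; congr nat_of_bool; rewrite !perm1.
case: (ltngtP j k) => [/s_inc -> //|/s_inc|/val_inj ->]; last by rewrite ltnn.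
by move=> /ltnW; rewrite leqNgt => /negbTE.
Qed.

(** Off [i0], the rank of [s k] is the rank of [k] among the points other than
    [i0], plus one if [s i0] lies below [s k].  Two candidates for [s k] could
    thus only differ by one, and then the smaller would be [s i0] itself. *)
Lemma perm_increasing_off_inj n (i0 : 'I_n) (s s' : 'S_n) :
    (forall i j, i != i0 -> j != i0 -> (i < j)%N -> (s i < s j)%N) ->
    (forall i j, i != i0 -> j != i0 -> (i < j)%N -> (s' i < s' j)%N) ->
  s i0 = s' i0 -> s = s'.
Proof.
have rank_off (r : 'S_n) k : k != i0 ->
    (forall i j, i != i0 -> j != i0 -> (i < j)%N -> (r i < r j)%N) ->
    r k = ((r i0 < r k) + \sum_(j < n | j != i0) (j < k)%N)%N :> nat.
  move=> k_off r_inc; rewrite -[LHS]perm_rank (bigD1 i0) //=; congr addn.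
  apply: eq_bigr => j j_off; congr nat_of_bool.
  case: (ltngtP j k) => [ltjk|ltkj|/val_inj ->]; last by rewrite ltnn.
    exact: r_inc.
  by apply/negbTE; rewrite -leqNgt ltnW // r_inc.
move=> s_inc s'_inc eq_i0; apply/permP => k.
have [-> //|k_off] := eqVneq k i0; apply: val_inj => /=.
have := rank_off s' _ k_off s'_inc; have := rank_off s _ k_off s_inc.
have s_neq : s k != s i0 :> nat.
  by apply: contra k_off => /eqP/val_inj/perm_inj ->.
have s'_neq : s' k != s i0 :> nat.
  by rewrite eq_i0; apply: contra k_off => /eqP/val_inj/perm_inj ->.
rewrite -eq_i0; move: s_neq s'_neq; set c := (\sum_(j < n | _) _)%N.
move: (s k : nat) (s' k : nat) (s i0 : nat) => p q r.
lia.
Qed.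

(** * Unshuffles whose second block is one letter *)

Lemma val_lift_max n (i : 'I_n.+1) (k : 'I_n.+1) :
  lift_perm ord_max i 1 k = (if k == n :> nat then i : nat else bump i k) :> nat.
Proof.
case: (unliftP ord_max k) => [j|] ->.
  by rewrite lift_perm_lift perm1 lift_max ltn_eqF.
by rewrite lift_perm_id eqxx.
Qed.

(** An (n, 1)-unshuffle is determined by the letter [i] it puts last; the
    others keep their order, which is what lifting the identity does. *)
Lemma big_unshuffle_max (T : Type) (idx : T) (op : Monoid.com_law idx) n
    (F : 'S_n.+1 -> T) :
  \big[op/idx]_(s | unshuffle n s) F s =
  \big[op/idx]_(i < n.+1) F (lift_perm ord_max i 1%g).
Proof.
have max_off (k : 'I_n.+1) : k != ord_max -> (k < n)%N.
  by rewrite -val_eqE /= ltn_neqAle -ltnS ltn_ord andbT.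
have unshuffle_inc (s : 'S_n.+1) : unshuffle n s ->
    forall i j, i != ord_max -> j != ord_max -> (i < j)%N -> (s i < s j)%N.
  move=> /forallP s_un i j _ j_off ltij.
  by have /forallP/(_ j)/implyP := s_un i; rewrite ltij max_off //; apply.
have unshuffle_lift i : unshuffle n (lift_perm ord_max i 1 : 'S_n.+1).
  apply/forallP => j; apply/forallP => k; apply/implyP => /andP[ltjk].
  rewrite (leqNgt n) (leq_trans ltjk) ?orbF => [ltkn|]; last by rewrite -ltnS.
  rewrite !val_lift_max !ltn_eqF // ?(ltn_trans ltjk) //.
  by rewrite ltnNge leq_bump2 -ltnNge.
rewrite (reindex_onto (fun i => lift_perm ord_max i 1%g)
                      (fun s : 'S__ => s ord_max)).
  by apply: eq_bigl => i; rewrite unshuffle_lift lift_perm_id eqxx.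
move=> s s_un; apply: (@perm_increasing_off_inj _ ord_max).
- exact/unshuffle_inc/unshuffle_lift.
- exact: unshuffle_inc.
- by rewrite lift_perm_id.
Qed.

Section Signs.
Variable K : fieldType.

Lemma chi1 n (d : n.-tuple int) : chi K 1 d = 1.
Proof.
rewrite /chi odd_perm1 mul1r /koszul big1 // => i _; rewrite big1 // => j.
by rewrite !perm1 => /andP[ltij]; rewrite ltnNge ltnW.
Qed.

(** The inversions of this permutation are the letters to the right of the
    [i]-th one, each of which is crossed once when [i] moves to the end. *)
Lemma chi_lift_max n (i : 'I_n.+1) (d : n.+1.-tuple int) :
  chi K (lift_perm ord_max i 1) d =
  (-1) ^+ (i + n) *
  \prod_(j < n)
     (if (i <= j)%N then (-1) ^ (tnth d (lift i j) * tnth d i) else 1).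
Proof.
rewrite /chi odd_lift_perm odd_perm1 addbF addbC -oddD
  signr_odd addnC; congr (_ * _).
(* An inversion (j, k) has k = ord_max: the first n values increase. *)
rewrite /koszul big_ord_recr /= [X in _ * X]big_pred0 ?mulr1 => [|j]; last first.
  by rewrite ltnNge -ltnS ltn_ord.
apply: eq_bigr => j _ /=.
rewrite big_mkcond big_ord_recr /= big1 ?mul1r => [|k _]; last first.
  by rewrite !val_lift_max /= !ltn_eqF // ifF //; rewrite /bump; lia.
rewrite ltn_ord !val_lift_max /= eqxx ltn_eqF //=.
have -> : widen_ord (leqnSn n) j = lift ord_max j.
  by apply: val_inj; rewrite /= /bump leqNgt ltn_ord.
rewrite lift_perm_lift lift_perm_id perm1.
by congr (if _ then _ else _); rewrite /bump; lia.
Qed.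

End Signs.

(** * Multilinear maps on short tuples *)

Section Multilinear.
Variables (K : fieldType) (V : vectType K).

Lemma set_tuple_id (T : Type) n (t : n.-tuple T) i : set_tuple t i (tnth t i) = t.
Proof.
by apply: eq_from_tnth => j; rewrite tnth_mktuple; case: eqP => [->|].
Qed.

Lemma multilinear0 n (f : n.-tuple V -> V) (t : n.-tuple V) i :
  multilinear f -> tnth t i = 0 -> f t = 0.
Proof.
move=> f_lin ti0; rewrite -(set_tuple_id t i) ti0.
have /= := f_lin t i (-1) 0 0; rewrite scaler0 addr0 scaleN1r => ->.
by rewrite addrC; apply/eqP; rewrite subr_eq0.
Qed.

Lemma multilinearZ n (f : n.-tuple V -> V) (t : n.-tuple V) i k u :
  multilinear f -> f (set_tuple t i (k *: u)) = k *: f (set_tuple t i u).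
Proof.
move=> f_lin; have /= := f_lin t i k u 0; rewrite !addr0 => ->.
rewrite [X in _ + X](multilinear0 (i := i) f_lin) ?addr0 //.
by rewrite tnth_mktuple eqxx.
Qed.

Lemma multilinear_1 (f : 1.-tuple V -> V) :
  multilinear f -> linear (fun u => f [tuple u]).
Proof.
have setE y : set_tuple [tuple 0 : V] ord0 y = [tuple y].
  by apply: eq_from_tnth => j; rewrite tnth_mktuple !ord1.
by move=> f_lin k u1 u2; have /= := f_lin [tuple 0] ord0 k u1 u2; rewrite !setE.
Qed.

Lemma multilinear2Z (f : 2.-tuple V -> V) k1 k2 u1 u2 :
  multilinear f -> f [tuple k1 *: u1; k2 *: u2] = (k1 * k2) *: f [tuple u1; u2].
Proof.
have set0E (y1 y2 y : V) : set_tuple [tuple y1; y2] ord0 y = [tuple y; y2].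
  by apply: val_inj; rewrite /= enum_ordSl enum_ordSl enum_ord0.
have set1E (y1 y2 y : V) : set_tuple [tuple y1; y2] ord_max y = [tuple y1; y].
  by apply: val_inj; rewrite /= enum_ordSl enum_ordSl enum_ord0.
move=> f_lin; rewrite -(set0E u1) multilinearZ // set0E -(set1E _ u2).
by rewrite multilinearZ // set1E scalerA.
Qed.
End Multilinear.

(** * The action of these permutations on short tuples *)

Lemma perm_tuple1 (T : Type) n (t : n.-tuple T) : perm_tuple 1 t = t.
Proof. by apply: eq_from_tnth => i; rewrite tnth_mktuple perm1. Qed.

Lemma nth_perm_lift_max (T : Type) (t0 : T) n (i : 'I_n.+1)
    (t : n.+1.-tuple T) k :
  (k <= n)%N ->
  nth t0 (perm_tuple (lift_perm ord_max i 1) t) k =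
  nth t0 t (if k == n then i : nat else bump i k)%N.
Proof.
move=> le_kn.
have /= <- := tnth_nth t0 (perm_tuple (lift_perm ord_max i 1) t)
                (Ordinal (le_kn : k < n.+1)%N).
by rewrite tnth_mktuple (tnth_nth t0) val_lift_max.
Qed.

Lemma perm_tuple_lift_max2 (T : Type) (i : 'I_2) (t0 t1 : T) :
  perm_tuple (lift_perm ord_max i 1) [tuple t0; t1] =
  if i == 0 :> nat then [tuple t1; t0] else [tuple t0; t1].
Proof.
apply: val_inj; apply: (@eq_from_nth _ t0) => [|k].
  exact: etrans (size_tuple _) (esym (size_tuple _)).
rewrite (size_tuple (perm_tuple _ _)) => ltk.
rewrite nth_perm_lift_max //.
by case: i => [[|[|]]] //= _; case: k ltk => [|[|]].
Qed.

Lemma perm_tuple_lift_max3 (T : Type) (i : 'I_3) (t0 t1 t2 : T) :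
  perm_tuple (lift_perm ord_max i 1) [tuple t0; t1; t2] =
  if i == 0 :> nat then [tuple t1; t2; t0]
  else if i == 1%N :> nat then [tuple t0; t2; t1] else [tuple t0; t1; t2].
Proof.
apply: val_inj; apply: (@eq_from_nth _ t0) => [|k].
  exact: etrans (size_tuple _) (esym (size_tuple _)).
rewrite (size_tuple (perm_tuple _ _)) => ltk.
rewrite nth_perm_lift_max //.
by case: i => [[|[|[|]]]] //= _; case: k ltk => [|[|[|]]].
Qed.

(** * Jacobiators of arity at most three *)

Section UnshuffleSums.
Variables (K : fieldType) (V : vectType K) (l : forall n, n.-tuple V -> V).

Lemma unshuffle_sum_full n (d : n.-tuple int) (t : n.-tuple V) :
  unshuffle_sum l n d t = l [tuple of l [tuple of take n t] :: drop n t].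
Proof.
rewrite /unshuffle_sum (big_pred1 1%g) => [|s].
  by rewrite chi1 scale1r perm_tuple1.
apply/idP/eqP => [/forallP s_un | ->].
  apply: perm_increasing_eq1 => i j ltij.
  by have /forallP/(_ j)/implyP := s_un i; rewrite ltij ltn_ord; apply.
apply/forallP => i; apply/forallP => j.
by apply/implyP => /andP[ltij _]; rewrite !perm1.
Qed.

Lemma unshuffle_sum_1_2 d0 d1 (t0 t1 : V) :
  unshuffle_sum l 1 [tuple d0; d1] [tuple t0; t1] =
    l [tuple l [tuple t0]; t1]
    - (-1) ^ (d0 * d1) *: l [tuple l [tuple t1]; t0].
Proof.
rewrite /unshuffle_sum big_unshuffle_max !big_ord_recl big_ord0 !perm_tuple_lift_max2 /=.
rewrite !chi_lift_max !big_ord_recl !big_ord0 /bump /= ?mulr1 ?mul1r.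
rewrite !(tnth_nth 0) /= /bump /= ?(addSn, add0n) !exprS expr0.
rewrite !(mulN1r, mulr1, mul1r, opprK, scaleNr, scale1r).
rewrite addr0 addrC mulrC.
(* The inner tuples agree up to their proofs of size. *)
by congr (_ - _ *: _); congr (@l 2 _); apply: val_inj => /=;
  congr [:: @l 1 _; _]; apply: val_inj.
Qed.

Lemma unshuffle_sum_2_3 d0 d1 d2 (t0 t1 t2 : V) :
  unshuffle_sum l 2 [tuple d0; d1; d2] [tuple t0; t1; t2] =
    l [tuple l [tuple t0; t1]; t2]
    - (-1) ^ (d1 * d2) *: l [tuple l [tuple t0; t2]; t1]
    + (-1) ^ (d0 * (d1 + d2)) *: l [tuple l [tuple t1; t2]; t0].
Proof.
rewrite /unshuffle_sum big_unshuffle_max !big_ord_recl big_ord0 !perm_tuple_lift_max3 /=.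
rewrite !chi_lift_max !big_ord_recl !big_ord0 /bump /= ?mulr1 ?mul1r.
rewrite !(tnth_nth 0) /= /bump /= ?(addSn, add0n) !exprS expr0.
rewrite !(mulN1r, mulr1, mul1r, opprK, scaleNr, scale1r).
rewrite -expfzDr ?oppr_eq0 ?oner_eq0 // -mulrDl [_ * d0]mulrC [d2 * d1]mulrC.
rewrite addr0 addrC [- _ + _]addrC.
by congr (_ - _ *: _ + _ *: _); congr (@l 2 _); apply: val_inj => /=;
  congr [:: @l 2 _; _]; apply: val_inj.
Qed.
End UnshuffleSums.

Section LowJacobiators.
Variables (K : fieldType) (V : vectType K) (l : forall n, n.-tuple V -> V).

Lemma jacobiator_1 d0 (t0 : V) :
  jacobiator l [tuple d0] [tuple t0] = l [tuple l [tuple t0]].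
Proof.
rewrite /jacobiator big_nat1 scale1r unshuffle_sum_full.
by congr (@l 1 _); apply: val_inj => /=; congr [:: @l 1 _]; apply: val_inj.
Qed.

Lemma jacobiator_2 d0 d1 (t0 t1 : V) :
  jacobiator l [tuple d0; d1] [tuple t0; t1] =
    l [tuple l [tuple t0; t1]] - l [tuple l [tuple t0]; t1]
    + (-1) ^ (d0 * d1) *: l [tuple l [tuple t1]; t0].
Proof.
rewrite /jacobiator big_nat_recl // big_nat1 unshuffle_sum_1_2 unshuffle_sum_full.
rewrite /= scaleN1r scale1r opprB addrC addrA addrAC.
congr (_ - _ + _); congr (@l 1 _); apply: val_inj => /=.
by congr [:: @l 2 _]; apply: val_inj.
Qed.

(** In every other term of the third Jacobiator [l 1] occurs, as the inner or
    as the outer operator. *)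
Lemma jacobiator_3_minimal (d : 3.-tuple int) (t : 3.-tuple V) :
    multilinear (@l 3) -> (forall u : 1.-tuple V, l u = 0) ->
  jacobiator l d t = unshuffle_sum l 2 d t.
Proof.
move=> lin3 l1_0.
have U3 : unshuffle_sum l 3 d t = 0 by rewrite unshuffle_sum_full; apply: l1_0.
have U1 : unshuffle_sum l 1 d t = 0.
  apply: big1 => s _.
  rewrite [X in _ *: X](multilinear0 (i := ord0) lin3) ?scaler0 //.
  by rewrite (tnth_nth 0); apply: l1_0.
rewrite /jacobiator big_nat_recl // big_nat_recl // big_nat1 U1 U3.
by rewrite !scaler0 add0r addr0 expr2 mulN1r opprK scale1r.
Qed.
End LowJacobiators.

(** * The Jacobi identity for a bracket on three lines *)

(** The value on two basis vectors of degrees [i] and [j] has degree [i + j],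
    so it is this multiple of the basis vector of degree [i + j]. *)
Definition bracket_coef (K : fieldType) (a b c : K) (i j : nat) : K :=
  match i, j with
  | 0, 1 => a | 1, 0 => - a
  | 1, 1 => b
  | 0, 2 => c | 2, 0 => - c
  | _, _ => 0
  end.

Section ThreeLines.
Variables (K : fieldType) (V : vectType K) (Vg : int -> {vspace V}).
Variables (v w x : V).
Hypotheses (V0 : Vg 0 = <[v]>%VS) (V1 : Vg 1 = <[w]>%VS)
  (V2 : Vg 2 = <[x]>%VS).
Hypothesis V_other : forall i : int, i \notin [:: 0; 1; 2] -> Vg i = 0%VS.

(** The default value 0 of [nth] stands for the basis of the zero components:
    for [k >= 3] the vector is zero, and its degree is arbitrary. *)
Lemma homogeneous_cases (d : int) u : u \in Vg d ->
  exists (k : nat) (alpha : K),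
    u = alpha *: [:: v; w; x]`_k /\ ((k < 3)%N -> d = k%:Z).
Proof.
have [|d_out] := boolP (d \in [:: 0; 1; 2]); last first.
  rewrite V_other // memv0 => /eqP ->; exists 3%N, 0.
  by rewrite scale0r.
rewrite !inE => /or3P[] /eqP ->; rewrite ?V0 ?V1 ?V2 => /vlineP[alpha ->].
- by exists 0%N, alpha.
- by exists 1%N, alpha.
- by exists 2%N, alpha.
Qed.

Variables (l : forall r : nat, r.-tuple V -> V) (a b c : K).
Hypothesis lin2 : multilinear (@l 2).
Hypothesis l2_basis : forall i j : nat,
  l [tuple [:: v; w; x]`_i; [:: v; w; x]`_j] =
  bracket_coef a b c i j *: [:: v; w; x]`_(i + j).

(** The identity holds trivially where the total degree is at least 3; the
    ten remaining triples of degrees give scalar identities, of which only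
    those on the arrangements of v, w, w depend on the constants. *)
Lemma Jacobi_identity_iff : x != 0 ->
  (forall (d : 3.-tuple int) (t : 3.-tuple V),
     homogeneous Vg d t -> unshuffle_sum l 2 d t = 0) <->
  b * c = 2%:R * a * b.
Proof.
move=> x_neq0; set e := nth 0 [:: v; w; x]; set m := bracket_coef a b c.
have l2Z k1 k2 i j : l [tuple k1 *: e i; k2 *: e j] =
    (k1 * k2 * m i j) *: e (i + j)%N.
  by rewrite multilinear2Z // l2_basis scalerA.
have JacobiE (d0 d1 d2 : int) al0 al1 al2 i j k :
  unshuffle_sum l 2 [tuple d0; d1; d2]
                    [tuple al0 *: e i; al1 *: e j; al2 *: e k] =
  (al0 * al1 * al2 * (m i j * m (i + j)%N k
    - (-1) ^ (d1 * d2) * (m i k * m (i + k)%N j)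
    + (-1) ^ (d0 * (d1 + d2)) * (m j k * m (j + k)%N i))) *: e (i + j + k)%N.
  rewrite unshuffle_sum_2_3 !l2Z (addnAC i k) [(j + k + i)%N]addnC addnA
    !scalerA.
  by rewrite -scaleNr -!scalerDl; congr (_ *: _); ring.
split=> [Jacobi | bc d t hom].
  have hom :
      homogeneous Vg [tuple 0; 1; 1] [tuple 1 *: e 0; 1 *: e 1; 1 *: e 1].
    move=> i; rewrite !(tnth_nth 0) !scale1r.
    by case: i => [[|[|[|]]]] //= _; rewrite ?V0 ?V1 memv_line.
  move/eqP: (Jacobi _ _ hom).
  rewrite JacobiE scaler_eq0 (negbTE x_neq0) orbF mulr1 mul0r
    expr0z expr1z /m /= => /eqP eq0.
  by apply/eqP; rewrite -subr_eq0 -oppr_eq0 -eq0; apply/eqP; ring.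
case/tupleP: d hom => d0 d; case/tupleP: d => d1 d; case/tupleP: d => d2 d.
rewrite (tuple0 d) {d}.
case/tupleP: t => t0 t; case/tupleP: t => t1 t; case/tupleP: t => t2 t.
rewrite (tuple0 t) {t} => hom.
have /homogeneous_cases[k0 [al0 [-> deg0]]] : t0 \in Vg d0
  by exact: (hom ord0).
have /homogeneous_cases[k1 [al1 [-> deg1]]] : t1 \in Vg d1
  by exact: (hom (Ordinal (isT : 1 < 3)%N)).
have /homogeneous_cases[k2 [al2 [-> deg2]]] : t2 \in Vg d2
  by exact: (hom ord_max).
rewrite JacobiE; have [k_out | k_in] := leqP 3 (k0 + k1 + k2).
  by rewrite /e [X in _ *: X]nth_default // scaler0.
rewrite deg0 ?deg1 ?deg2; try lia.
rewrite -PoszD -!PoszM -!exprnP.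
rewrite [X in X *: _](_ : _ = 0) ?scale0r // {hom deg0 deg1 deg2}.
by case: k0 k_in => [|[|[|//]]]; case: k1 => [|[|[|//]]];
  case: k2 => [|[|[|//]]] //= _; rewrite /m /=; ring: bc.
Qed.
End ThreeLines.

(** * The differential graded Lie algebras among the given structures *)

Theorem theorem3p11 (K : fieldType) (charK0 : [pchar K] =i pred0)
  (V : vectType K) (Vg : int -> {vspace V}) (v w x : V)
  (V_sum : (Vg 0%R + Vg 1%R + Vg 2%R)%VS = fullv)
  (V_direct : directv (Vg 0%R + Vg 1%R + Vg 2%R)%VS)
  (V0 : Vg 0 = <[v]>%VS) (V1 : Vg 1 = <[w]>%VS) (V2 : Vg 2 = <[x]>%VS)
  (dimV0 : \dim (Vg 0) = 1%N) (dimV1 : \dim (Vg 1) = 1%N)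
  (dimV2 : \dim (Vg 2) = 1%N)
  (V_other : forall i : int, i \notin [:: 0; 1; 2] -> Vg i = 0%VS)
  (l : forall r : nat, r.-tuple V -> V) (a b c : nat -> K)
  (l_operator : forall r, (1 <= r)%N -> L_operator Vg (@l r))
  (l_a : forall r (t : r.-tuple V), (1 <= r)%N ->
     t = v :: nseq (r - 1)%N w :> seq V -> l r t = a r *: w)
  (l_b : forall r (t : r.-tuple V), (1 <= r)%N ->
     t = nseq r w :> seq V -> l r t = b r *: x)
  (l_c : forall r (t : r.-tuple V), (2 <= r)%N ->
     t = v :: rcons (nseq (r - 2)%N w) x :> seq V -> l r t = c r *: x)
  (l_other : forall r (t : r.-tuple V), (1 <= r)%N ->
     {subset t <= [:: v; w; x]} ->
     ~~ perm_eq t (v :: nseq (r - 1)%N w) ->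
     ~~ perm_eq t (nseq r w) ->
     ~~ perm_eq t (v :: rcons (nseq (r - 2)%N w) x) -> l r t = 0)
  (L3 : L_structure Vg l 3) :
  dg_Lie_algebra Vg l <-> (b 1%N = 0 \/ b 2%N = 0 \/ a 2%N = 0).
Proof.
have [L_op jac0] := L3.
have lin1 : multilinear (l 1%N) by have [] := L_op 1%N isT.
have lin2 : multilinear (l 2) by have [] := L_op 2 isT.
have lin3 : multilinear (l 3) by have [] := L_op 3 isT.
have l1D k u1 u2 :
    l 1%N [tuple k *: u1 + u2] = k *: l 1%N [tuple u1] + l 1%N [tuple u2].
  exact: (multilinear_1 lin1).
have l1Z k u : l 1%N [tuple k *: u] = k *: l 1%N [tuple u].
  by rewrite -[k *: u]addr0 l1D [X in _ + X](multilinear0 (i := ord0) lin1)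
    ?addr0.
have skew2 : skew_symmetric Vg (l 2) by have [] := L_op 2 isT.
have x_neq0 : x != 0.
  by apply/eqP => x0; move: dimV2; rewrite V2 x0 dim_vline eqxx.
have dim_le1 (u : V) : (\dim <[u]> <= 1)%N by rewrite dim_vline leq_b1.
have dimD (A B : {vspace V}) : (\dim (A + B) <= \dim A + \dim B)%N.
  by have [] := dimv_add_leqif A B.
have dim3 : \dim (<[v]> + <[w]> + <[x]>) = 3.
  rewrite -V0 -V1 -V2; move: V_direct.
  by rewrite directvE /= dimV0 dimV1 dimV2 => /eqP.
have vw : (v == w) = false.
  apply/negP => /eqP vw; move: dim3; rewrite vw addvv.
  have := dimD <[w]>%VS <[x]>%VS; have := dim_le1 w; have := dim_le1 x; lia.
have vx : (v == x) = false.
  apply/negP => /eqP vx; move: dim3; rewrite vx (addvC <[x]>%VS) -addvA addvv.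
  have := dimD <[w]>%VS <[x]>%VS; have := dim_le1 w; have := dim_le1 x; lia.
have wx : (w == x) = false.
  apply/negP => /eqP wx; move: dim3; rewrite wx -addvA addvv.
  have := dimD <[v]>%VS <[x]>%VS; have := dim_le1 v; have := dim_le1 x; lia.
have neqs := (eqxx, vw, vx, wx, eq_sym w v, eq_sym x v, eq_sym x w).
have l1v : l 1%N [tuple v] = a 1%N *: w by apply: l_a.
have l1w : l 1%N [tuple w] = b 1%N *: x by apply: l_b.
have l1x : l 1%N [tuple x] = 0.
  apply: l_other; rewrite /perm_eq /= ?neqs // => y.
  by rewrite !inE => ->; rewrite !orbT.
have vw2 : l 2 [tuple v; w] = a 2 *: w by apply: l_a.
have ww2 : l 2 [tuple w; w] = b 2 *: x by apply: l_b.
have vx2 : l 2 [tuple v; x] = c 2 *: x by apply: l_c.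
have [vv2 wx2 xw2 xx2] : [/\ l 2 [tuple v; v] = 0, l 2 [tuple w; x] = 0,
    l 2 [tuple x; w] = 0 & l 2 [tuple x; x] = 0].
  by split; apply: l_other; rewrite /perm_eq /= ?neqs // => y; rewrite !inE;
    move=> /orP[] ->; rewrite ?orbT.
have v_hom : v \in Vg 0 by rewrite V0 memv_line.
have w_hom : w \in Vg 1 by rewrite V1 memv_line.
have x_hom : x \in Vg 2 by rewrite V2 memv_line.
have swap2 (d : int) u : u \in Vg d -> l 2 [tuple u; v] = - l 2 [tuple v; u].
  move=> u_hom.
  have hom : homogeneous Vg [tuple 0; d] [tuple v; u].
    by move=> i; rewrite !(tnth_nth 0); case: i => [[|[|]]].
  have := skew2 _ _ (lift_perm ord_max ord0 1) hom.
  rewrite chi_lift_max /= big_ord1 /= !(tnth_nth 0) /=.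
  rewrite mulr0 expr0z mulr1 expr1 scaleN1r => <-.
  by rewrite perm_tuple_lift_max2.
have l2_basis i j : l 2 [tuple [:: v; w; x]`_i; [:: v; w; x]`_j] =
    bracket_coef (a 2) (b 2) (c 2) i j *: [:: v; w; x]`_(i + j).
  have [i_out | ] := leqP 3 i.
    rewrite [X in _ *: X]nth_default ?(leq_trans i_out (leq_addr _ _)) // scaler0.
    by apply: (multilinear0 (i := ord0) lin2); rewrite (tnth_nth 0) /= nth_default.
  have [j_out _ | ] := leqP 3 j.
    rewrite [X in _ *: X]nth_default ?(leq_trans j_out (leq_addl _ _)) // scaler0.
    by apply: (multilinear0 (i := ord_max) lin2); rewrite (tnth_nth 0) /= nth_default.
  case: j => [|[|[|//]]] _; case: i => [|[|[|//]]] _ /=; rewrite ?scale0r ?scaleNr //.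
  - by rewrite (swap2 1) // vw2.
  - by rewrite (swap2 2) // vx2.
have Jacobi := Jacobi_identity_iff V0 V1 V2 V_other lin2 l2_basis x_neq0.
have J1 : a 1%N * b 1%N = 0.
  have hom : homogeneous Vg [tuple 0] [tuple v] by move=> i; rewrite !ord1.
  have /eqP := jac0 1%N _ _ isT hom.
  rewrite jacobiator_1 l1v l1Z l1w scalerA scaler_eq0 (negbTE x_neq0) orbF.
  by move=> /eqP.
have J2 : a 2 * b 1%N = a 1%N * b 2 + b 1%N * c 2.
  have hom : homogeneous Vg [tuple 0; 1] [tuple v; w].
    by move=> i; rewrite !(tnth_nth 0); case: i => [[|[|]]].
  have /eqP := jac0 2 _ _ isT hom.
  have l2Zl k u1 u2 : l 2 [tuple k *: u1; u2] = k *: l 2 [tuple u1; u2].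
    by rewrite -[u2 in LHS]scale1r multilinear2Z // mulr1.
  rewrite jacobiator_2 vw2 l1v l1w l1Z l1w !l2Zl ww2 (swap2 2) // vx2.
  rewrite mul0r expr0z scale1r scalerN !scalerA -!scalerBl scaler_eq0.
  rewrite (negbTE x_neq0) orbF => /eqP eq0.
  by apply/eqP; rewrite -subr_eq0 -eq0; apply/eqP; ring.
have L2 : L_structure Vg l 2.
  split=> [k /andP[k1 k2] | n d t /andP[n1 n2]]; [apply: L_op | apply: jac0].
    by rewrite k1 ltnW.
  by rewrite n1 ltnW.
have J3 : a 1%N = 0 -> b 1%N = 0 -> dg_Lie_algebra Vg l.
  move=> a1 b1; have l1_0 u : l 1%N u = 0.
    case/tupleP: u => y u; rewrite (tuple0 u) {u}.
    have : y \in fullv by apply: memvf.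
    rewrite -V_sum V0 V1 V2 => /memv_addP[_ /memv_addP[_ /vlineP[al ->]
      [_ /vlineP[be ->] ->]] [_ /vlineP[ga ->] ->]].
    by rewrite -addrA !l1D l1Z l1v l1w l1x a1 b1 !scale0r !scaler0 !addr0.
  split=> // d t hom.
  by rewrite -jacobiator_3_minimal //; apply: jac0.
split=> [[_ /Jacobi bc] | ].
  have [b1 | b1_neq0] := eqVneq (b 1%N) 0; first by left.
  have [b2 | b2_neq0] := eqVneq (b 2) 0; first by right; left.
  right; right; apply/eqP.
  have a1 : a 1%N = 0.
    by move/eqP: J1; rewrite mulf_eq0 (negbTE b1_neq0) orbF => /eqP.
  have a2c2 : a 2 = c 2.
    by apply: (mulIf b1_neq0); rewrite J2 a1 mul0r add0r mulrC.
  move: bc; rewrite -a2c2 => /eqP; rewrite -subr_eq0.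
  have -> : b 2 * a 2 - 2%:R * a 2 * b 2 = - (a 2 * b 2) by ring.
  by rewrite oppr_eq0 mulf_eq0 (negbTE b2_neq0) orbF.
have dgI : b 2 * c 2 = 2%:R * a 2 * b 2 -> dg_Lie_algebra Vg l.
  by move=> /Jacobi.
have [b2 _ | b2_neq0] := eqVneq (b 2) 0.
  by apply: dgI; rewrite b2 mul0r mulr0.
have [b1 _ | b1_neq0] := eqVneq (b 1%N) 0.
  apply: J3 => //; apply: (mulIf b2_neq0).
  by move: J2; rewrite b1 mulr0 !mul0r addr0.
move=> [/eqP|[/eqP|a2]]; rewrite ?(negbTE b1_neq0) ?(negbTE b2_neq0) //.
have a1 : a 1%N = 0.
  by move/eqP: J1; rewrite mulf_eq0 (negbTE b1_neq0) orbF => /eqP.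
have c2 : c 2 = 0.
  move: J2; rewrite a1 a2 !mul0r add0r => /esym/eqP.
  by rewrite mulf_eq0 (negbTE b1_neq0) => /eqP.
by apply: dgI; rewrite c2 a2 !mulr0 mul0r.
Qed.
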